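(* For every $m\ge0$ there is an isomorphism $\Omega_m\cong\mathbb{R}^m\times\flat\Omega$ in $\mathbf{SSS}$, so that, for $\mathcal{Y}\in\mathbf{SSS}$, a sampler, i.e. a sample-smooth map $\mathbb{R}^m\times\flat\Omega\to\mathcal{Y}$, is the same thing as an element of $\mathcal{Y}^{\Omega_m}$; and the law map $Y\mapsto\bigl(\theta\mapsto(Y(\theta,-))_*U\bigr)$ induces a bijection $$\mathcal{Y}^{\Omega_m}/\!\sim\ \ \xrightarrow{\ \cong\ }\ \ \mathbf{SSS}(\mathbb{R}^m,\mathsf{P}(\mathcal{Y})),\qquad Y\sim Y'\ :\Longleftrightarrow\ (Y(\theta,-))_*U=(Y'(\theta,-))_*U\ \ \forall\theta\in\mathbb{R}^m,$$ the right-hand side being the set $\mathrm{Kl}(\mathsf{P})(\mathbb{R}^m,\mathcal{Y})$ of Kleisli morphisms from $\mathbb{R}^m$ to $\mathcal{Y}$.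
   Context: **Sample space.** $\Omega=[0,1]^{\mathbb{N}}$; $\mathcal{B}_\Omega$ is the universal completion of its Borel (product) $\sigma$-algebra, i.e. all universally measurable subsets; $\Omega^\Omega$ is the set of all $\mathcal{B}_\Omega$-$\mathcal{B}_\Omega$-measurable self-maps of $\Omega$; $\mathsf{P}_\Omega$ is the set of all probability measures on $\mathcal{B}_\Omega$; $U=\bigotimes_{n}U[0,1]$ is the uniform measure. $\Theta=(\Theta_1,\Theta_2):\Omega\to\Omega\times\Omega$ is the Borel isomorphism de-interleaving the coordinates of a sequence (e.g. even- and odd-indexed coordinates); $\Theta_*U=U\otimes U$. **Site.** $\Omega_n:=\mathbb{R}^n\times\Omega$, $n\ge0$ ($\Omega_0=\Omega$). A map $g:\Omega_m\to\mathbb{R}^n$ is mixed-smooth, $g\in\mathcal{C}^\infty_{\mathrm{mix}}(\Omega_m,\mathbb{R}^n)$, if (M1) $g(-,\omega)\in C^\infty(\mathbb{R}^m,\mathbb{R}^n)$ for every $\omega$, and (M2) $g(t,-)$ is $\mathcal{B}_\Omega$-Borel measurable for every $t$. The category $\mathbb{S}$ has objects $\Omega_n$ and morphisms $\mathbb{S}(\Omega_m,\Omega_n)=\{(g,\Phi): g\in\mathcal{C}^\infty_{\mathrm{mix}}(\Omega_m,\mathbb{R}^n),\Phi\in\Omega^\Omega\}$, where $(g,\Phi)(t,\omega)=(g(t,\omega),\Phi(\omega))$. **Sample-smooth spaces.** A sample-smooth space is a set $\mathcal{X}$ with, for each $n\ge0$, a set $\mathcal{X}^{\Omega_n}$ of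 maps $\Omega_n\to\mathcal{X}$ (plots) containing all constant maps and such that $p\in\mathcal{X}^{\Omega_n}$, $h\in\mathbb{S}(\Omega_m,\Omega_n)$ imply $p\circ h\in\mathcal{X}^{\Omega_m}$. A map $f:\mathcal{X}\to\mathcal{Y}$ is sample-smooth (a morphism of $\mathbf{SSS}$) if $f\circ p\in\mathcal{Y}^{\Omega_n}$ for all $n$ and $p\in\mathcal{X}^{\Omega_n}$. Write $\mathcal{X}^\Omega:=\mathcal{X}^{\Omega_0}$. Products: $(\prod_i\mathcal{X}_i)^{\Omega_n}=\prod_i\mathcal{X}_i^{\Omega_n}$. $\mathbb{R}^k$ carries the plots $\mathcal{C}^\infty_{\mathrm{mix}}(\Omega_n,\mathbb{R}^k)$. The test object $\Omega_m$ is a sample-smooth space with plots $\Omega_m^{\Omega_n}:=\mathbb{S}(\Omega_n,\Omega_m)$. $\flat\Omega$ is the set $\Omega$ with plots $(\flat\Omega)^{\Omega_n}=\{(t,\omega)\mapsto\Phi(\omega):\Phi\in\Omega^\Omega\}$. The induced $\sigma$-algebra is $\mathcal{B}_{\mathcal{X}}:=\{A\subseteq\mathcal{X}: X^{-1}(A)\in\mathcal{B}_\Omega\ \forall X\in\mathcal{X}^\Omega\}$. **Space of measures.** $\mathsf{P}(\mathcal{X}):=\{X_*P: X\in\mathcal{X}^\Omega, P\in\mathsf{P}_\Omega\}$, a set of probability measures on $(\mathcal{X},\mathcal{B}_{\mathcal{X}})$, with plots $\mathsf{P}(\mathcal{X})^{\Omega_n}:=\{\mathsf{L}Y: Y\in\mathcal{X}^{\Omega_n}\}$,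 $\mathsf{L}Y(t,\omega):=(\omega'\mapsto Y(t,\Theta^{-1}(\omega,\omega')))_*U$. Kleisli morphisms $\mathcal{X}\to\mathcal{Y}$ are sample-smooth maps $\mathcal{X}\to\mathsf{P}(\mathcal{Y})$. *)

(* Defs.v *)
From HB Require Import structures.
From mathcomp Require Import all_boot all_order all_algebra.
From mathcomp Require Import all_classical all_reals all_analysis.

Set Implicit Arguments.
Unset Strict Implicit.
Unset Printing Implicit Defensive.

Import Order.TTheory GRing.Theory Num.Theory.
Import numFieldNormedType.Exports.

Local Open Scope classical_set_scope.
Local Open Scope ring_scope.
Local Open Scope quotient_scope.

Section sample_space.
Context (R : realType).

Definition cube : Type := nat -> {i01 R}.

HB.instance Definition _ := Choice.copy cube (nat -> {i01 R}).
HB.instance Definition _ := isPointed.Build cube (fun=> 0%:i01).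

Definition cylinders : set (set cube) :=
  [set C | exists (n : nat) (B : set R), measurable B /\
           C = [set w | B (w n)%:num]].

Definition cubeB := g_sigma_algebraType cylinders.

(* A is in the completion of the Borel sigma-algebra for every Borel P. *)
Definition universally_measurable (A : set cube) : Prop :=
  forall P : probability cubeB R, exists B C : set cubeB,
    [/\ measurable B, measurable C, B `<=` A, A `<=` C & P (C `\` B) = 0%E].

Lemma universally_measurable0 : universally_measurable set0.
Proof.
by move=> P; exists set0, set0; split => //; rewrite setD0 measure0.
Qed.

Lemma universally_measurableC (A : set cube) :
  universally_measurable A -> universally_measurable (~` A).
Proof.
move=> mA P; have [B [C [mB mC BA AC PCB]]] := mA P.
exists (~` C), (~` B); split; [exact: measurableC|exact: measurableC| | |].
- exact: subsetC.
- exact: subsetC.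
- by rewrite setDE setCK setIC -setDE.
Qed.

Lemma universally_measurable_bigcup (F : (set cube)^nat) :
  (forall i, universally_measurable (F i)) ->
  universally_measurable (\bigcup_i F i).
Proof.
move=> mF P.
have /choice[B /choice[C BC]] i := mF i P.
have mB i : measurable (B i) by have [] := BC i.
have mC i : measurable (C i) by have [] := BC i.
exists (\bigcup_i B i), (\bigcup_i C i); split.
- exact: bigcup_measurable.
- exact: bigcup_measurable.
- by apply: subset_bigcup => i _; have [] := BC i.
- by apply: subset_bigcup => i _; have [] := BC i.
- have mD i : measurable (C i `\` B i) by exact: measurableD.
  suff /negligibleP : P.-negligible (\bigcup_i C i `\` \bigcup_i B i).
    by apply; apply: measurableD; exact: bigcup_measurable.
  apply: (@negligibleS _ _ _ P (\bigcup_i (C i `\` B i))).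
    by move=> x [[i _ Cx] nB]; exists i => //; split => // Bx; apply: nB; exists i.
  by apply: negligible_bigcup => i; apply/negligibleP => //; have [] := BC i.
Qed.

Definition Omega : Type := cube.

HB.instance Definition _ := Pointed.on Omega.
HB.instance Definition _ := @isMeasurable.Build default_measure_display Omega
  universally_measurable universally_measurable0 universally_measurableC
  universally_measurable_bigcup.

(* The finite-dimensional marginals determine a probability measure on the
   Borel sets of the cube, hence on its universal completion. *)
Definition is_uniform (U : probability Omega R) : Prop :=
  forall (n : nat) (A : 'I_n -> set R), (forall i, measurable (A i)) ->
    U [set w : Omega | forall i : 'I_n, A i (w i)%:num] =
    (\prod_(i < n) uniform_prob (@ltr01 R) (A i))%E.

Definition Theta (w : Omega) : Omega * Omega :=
  (fun n => w n.*2, fun n => w n.*2.+1).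

Definition Theta_inv (ww' : Omega * Omega) : Omega :=
  fun n => if odd n then ww'.2 n./2 else ww'.1 n./2.

Lemma ThetaK : cancel Theta Theta_inv.
Proof.
move=> w; apply/funext => n; rewrite /Theta_inv /=.
by have := odd_double_half n; case: odd => /= [|]; rewrite ?add1n ?add0n => ->.
Qed.

Lemma Theta_invK : cancel Theta_inv Theta.
Proof.
move=> [w w']; rewrite /Theta /Theta_inv /=.
by congr pair; apply/funext => n; rewrite /= odd_double /= ?uphalf_double ?doubleK.
Qed.

End sample_space.

Section site.
Context (R : realType).

Definition OmegaN (n : nat) : Type := ('rV[R]_n * Omega R)%type.

(* In finite dimension, testing every directional derivative amounts to testing
   the Frechet derivative x |-> 'd f x. *)
Fixpoint Ck (m n k : nat) (f : 'rV[R]_m -> 'rV[R]_n) : Prop :=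
  if k is k'.+1 then
    (forall x, differentiable f x) /\ (forall v, Ck k' (fun x => 'D_v f x))
  else continuous f.

Definition smooth (m n : nat) (f : 'rV[R]_m -> 'rV[R]_n) : Prop :=
  forall k, Ck k f.

Definition borel_rV (n : nat) := g_sigma_algebraType (@open 'rV[R]_n).

Definition mixed_smooth (m n : nat) : set (OmegaN m -> 'rV[R]_n) :=
  [set g | (forall w, smooth (fun t => g (t, w))) /\
           (forall t, measurable_fun [set: Omega R]
                        (fun w => g (t, w) : borel_rV n))].

Definition site_hom (m n : nat) : set (OmegaN m -> OmegaN n) :=
  [set h | exists (g : OmegaN m -> 'rV[R]_n) (Phi : Omega R -> Omega R),
     [/\ mixed_smooth g, measurable_fun [set: Omega R] Phi &
         h = fun p => (g p, Phi p.2)]].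

End site.

Section sample_smooth_spaces.
Context (R : realType).

Record plotSpace := PlotSpace {
  carrier :> Type;
  plots : forall n, set (OmegaN R n -> carrier) }.

Record sss := SSS {
  sss_plotSpace :> plotSpace;
  plots_cst : forall n (x : sss_plotSpace),
    @plots sss_plotSpace n (fun=> x);
  plots_comp : forall m n (p : OmegaN R n -> sss_plotSpace)
    (h : OmegaN R m -> OmegaN R n),
    plots p -> site_hom h -> plots (p \o h) }.

Definition sample_smooth (X Y : plotSpace) (f : X -> Y) : Prop :=
  forall n (p : OmegaN R n -> X), plots p -> plots (f \o p).

(* sss is a full subcategory of the category of plot spaces: the morphisms
   between two sample-smooth spaces depend on their plots only. *)
Definition sss_hom (X Y : plotSpace) : Type := {f : X -> Y | sample_smooth f}.

Definition plot (X : plotSpace) (n : nat) : Type :=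
  {p : OmegaN R n -> X | plots p}.

HB.instance Definition _ X n := gen_eqMixin (plot X n).
HB.instance Definition _ X n := gen_choiceMixin (plot X n).

Definition prodS (X Y : plotSpace) : plotSpace :=
  @PlotSpace (X * Y)%type
    (fun n => [set p | plots (fst \o p) /\ plots (snd \o p)]).

Definition realS (k : nat) : plotSpace :=
  @PlotSpace 'rV[R]_k (fun n => @mixed_smooth R n k).

Definition OmegaS (m : nat) : plotSpace :=
  @PlotSpace (OmegaN R m) (fun n => @site_hom R n m).

Definition flatOmega : plotSpace :=
  @PlotSpace (Omega R) (fun n => [set p |
    exists2 Phi : Omega R -> Omega R, measurable_fun [set: Omega R] Phi &
      p = fun x => Phi x.2]).

(* Omega is identified with OmegaN R 0 = 'rV_0 * Omega. *)
Definition random_elements (X : plotSpace) : set (Omega R -> X) :=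
  [set x | plots (fun p : OmegaN R 0 => x p.2)].

Definition ind_measurable (X : plotSpace) : set (set X) :=
  [set A | forall x : Omega R -> X, random_elements x ->
             measurable (x @^-1` A)].

End sample_smooth_spaces.

Section measures.
Context (R : realType).

(* A measure on (X, B_X) is a function on the members of B_X only: the set
   functions of the library also take unspecified values outside of the
   sigma-algebra, on which equality of measures must not depend. *)
Definition measure_on (X : plotSpace R) : Type :=
  {A : set X | ind_measurable A} -> \bar R.

Definition law (X : plotSpace R) (P : probability (Omega R) R)
    (x : Omega R -> X) : measure_on X :=
  fun A => P (x @^-1` (sval A)).

Definition is_law (X : plotSpace R) (mu : measure_on X) : Prop :=
  exists (x : Omega R -> X) (P : probability (Omega R) R),
    random_elements x /\ mu = law P x.

Definition PS (U : probability (Omega R) R) (X : plotSpace R) : plotSpace R :=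
  @PlotSpace R {mu : measure_on X | is_law mu}
    (fun n => [set q | exists2 Y : OmegaN R n -> X, plots Y &
       forall t w, sval (q (t, w)) =
                   law U (fun w' => Y (t, Theta_inv (w, w')))]).

Context (U : probability (Omega R) R) (Y : plotSpace R) (m : nat).

Definition same_law : rel (plot Y m) := fun Z Z' =>
  `[< forall t : 'rV[R]_m,
        law U (fun w => sval Z (t, w)) = law U (fun w => sval Z' (t, w)) >].

Lemma same_law_equiv : equiv_class_of same_law.
Proof.
split.
- by move=> Z; exact/asboolP.
- by move=> Z Z'; apply/asboolP/asboolP => h t; rewrite h.
- by move=> Z1 Z2 Z3 /asboolP h12 /asboolP h23; apply/asboolP => t; rewrite h12.
Qed.

Canonical same_law_equivRel := EquivRelPack same_law_equiv.

Definition plot_mod_law : Type := {eq_quot same_law}.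

Definition plot_class (Z : plot Y m) : plot_mod_law := \pi_{eq_quot same_law} Z.

End measures.

(* Main.v *)
From HB Require Import structures.
Require Import Defs.
From mathcomp Require Import all_boot all_order all_algebra.
From mathcomp Require Import all_classical all_reals all_analysis.

Set Implicit Arguments.
Unset Strict Implicit.
Unset Printing Implicit Defensive.

(** The test object on m real parameters has the same underlying set as the
    product of the parameter space and of the discrete sample space, and both
    have the same plots: a pair consisting of a mixed-smooth map and a
    measurable map of the sample.  The identity is therefore the isomorphism,
    and a map out of the test object is sample-smooth exactly when it is a
    plot, by the Yoneda argument ([id_site_hom] and [plot_sample_smooth]).

    For the law map, the idea is that one sample splits into two, by
    de-interleaving.  Given a plot Z, its laws form a sample-smooth family
    ([law_family_sample_smooth]): along a random parameter g (s, w), a plot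
    that witnesses the smoothness of the family uses the even half of its sample
    to compute the parameter, and the odd half to run Z.  Conversely, let f be
    a sample-smooth family of laws.  The projection that forgets the sample is
    a plot of the parameter space, so f composed with it is the family of laws
    of a plot W whose sample is split in two, the law being taken in the second
    half only.  It does not depend on the first half, which can thus be frozen
    at any value w0: this gives a plot with laws f ([law_family_surjective]).
    Injectivity on classes is the definition of the equivalence.

    The halves, and the freezing of one of them, are measurable for the
    universally measurable sets because they are Borel
    ([borel_measurable_Omega]). *)

Import Order.TTheory GRing.Theory Num.Theory.
Import numFieldNormedType.Exports.

Local Open Scope classical_set_scope.
Local Open Scope ring_scope.
Local Open Scope quotient_scope.

(** * Measurable self-maps of the sample space *)

Section measurable_self_maps.
Context (R : realType).

(** Pulling back a sandwich of A for the image of P under Phi gives a sandwich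
    of the preimage of A for P. *)
Lemma borel_measurable_Omega (Phi : cubeB R -> cubeB R) :
  measurable_fun [set: cubeB R] Phi ->
  measurable_fun [set: Omega R] (Phi : Omega R -> Omega R).
Proof.
move=> mPhi _ A mA; rewrite setTI.
suff : universally_measurable (Phi @^-1` A) by [].
move=> P.
have mpre (B : set (cubeB R)) : measurable B -> measurable (Phi @^-1` B).
  by move=> mB; rewrite -[_ @^-1` _]setTI; exact: mPhi.
pose F : {mfun cubeB R >-> cubeB R} :=
  HB.pack Phi (isMeasurableFun.Build _ _ _ _ Phi mPhi).
have [B [C [mB mC BA AC PCB]]] := (mA : universally_measurable A) (distribution P F).
exists (Phi @^-1` B), (Phi @^-1` C); split.
- exact: mpre.
- exact: mpre.
- by move=> w /BA.
- by move=> w /AC.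
- exact: PCB.
Qed.

Lemma measurable_coordinate (k : nat) :
  measurable_fun [set: cubeB R] (fun w : cubeB R => (w k)%:num : R).
Proof.
by move=> _ B mB; rewrite setTI; apply: sub_sigma_algebra; exists k, B.
Qed.

Lemma measurable_coordinatewise (Phi : cubeB R -> cubeB R) :
  (forall n, measurable_fun [set: cubeB R] (fun w => (Phi w n)%:num : R)) ->
  measurable_fun [set: cubeB R] Phi.
Proof.
move=> mPhi; refine (@measurability _ _ (cubeB R) (cubeB R) _ _ (@cylinders R) erefl _).
move=> _ [_ [n [B [mB ->]]] <-].
by apply: mPhi.
Qed.

Lemma measurable_Theta1 :
  measurable_fun [set: Omega R] (fun w : Omega R => (Theta w).1).
Proof.
apply: borel_measurable_Omega; apply: measurable_coordinatewise => n.
exact: measurable_coordinate.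
Qed.

Lemma measurable_Theta2 :
  measurable_fun [set: Omega R] (fun w : Omega R => (Theta w).2).
Proof.
apply: borel_measurable_Omega; apply: measurable_coordinatewise => n.
exact: measurable_coordinate.
Qed.

Lemma measurable_Theta_inv_fixl (w0 : Omega R) :
  measurable_fun [set: Omega R] (fun w : Omega R => Theta_inv (w0, w)).
Proof.
apply: borel_measurable_Omega; apply: measurable_coordinatewise => n.
rewrite /Theta_inv /=; case: (odd n).
- exact: measurable_coordinate.
- exact: measurable_cst.
Qed.

End measurable_self_maps.

(** * Mixed-smooth maps and morphisms of the site *)

Section mixed_smooth_maps.
Context (R : realType).

Lemma smooth_cst (m n : nat) (c : 'rV[R]_n) :
  smooth (fun _ : 'rV[R]_m => c).
Proof.
move=> k; elim: k c => [|k IH] c /=; first exact: cst_continuous.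
split=> [x|v]; first exact: differentiable_cst.
suff -> : (fun x => 'D_v (fun _ : 'rV[R]_m => c) x) = (fun=> 0) by exact: IH.
by apply/funext => x; exact: derive_cst.
Qed.

Lemma smooth_id (n : nat) : smooth (fun t : 'rV[R]_n => t).
Proof.
case=> [|k] /=; first by move=> x; exact: cvg_id.
split=> [x|v]; first exact: ex_diff.
suff -> : (fun x => 'D_v (fun t : 'rV[R]_n => t) x) = (fun=> v).
  exact: smooth_cst.
by apply/funext => x; exact: derive_id.
Qed.

Lemma mixed_smooth_cst (m n : nat) (c : 'rV[R]_n) :
  mixed_smooth (fun _ : OmegaN R m => c).
Proof.
by split=> [w|t]; [exact: smooth_cst | exact: measurable_cst].
Qed.

Lemma mixed_smooth_fst (m : nat) :
  mixed_smooth (fun p : OmegaN R m => p.1).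
Proof.
by split=> [w|t]; [exact: smooth_id | exact: measurable_cst].
Qed.

Lemma mixed_smooth_comp_sample (m n : nat) (g : OmegaN R m -> 'rV[R]_n)
    (Phi : Omega R -> Omega R) :
  mixed_smooth g -> measurable_fun [set: Omega R] Phi ->
  mixed_smooth (fun p => g (p.1, Phi p.2)).
Proof.
move=> [gsm gme] mPhi; split=> [w|t]; first exact: (gsm (Phi w)).
exact: (measurableT_comp (gme t) mPhi).
Qed.

Lemma id_site_hom (m : nat) : site_hom (fun p : OmegaN R m => p).
Proof.
exists fst, id; split; [exact: mixed_smooth_fst | exact: measurable_id |].
by apply/funext => -[].
Qed.

End mixed_smooth_maps.

(** * Plots as maps out of the test object *)

Section test_object.
Context (R : realType) (m : nat).

Lemma OmegaN_to_prod_smooth :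
  @sample_smooth R (OmegaS R m) (prodS (realS R m) (flatOmega R)) id.
Proof.
by move=> n _ [g [Phi [mg mPhi ->]]]; split=> //; exists Phi.
Qed.

Lemma prod_to_OmegaN_smooth :
  @sample_smooth R (prodS (realS R m) (flatOmega R)) (OmegaS R m) id.
Proof.
move=> n p [/= mp1 [Phi mPhi p2E]]; exists (fst \o p), Phi; split=> //.
apply/funext => x /=; have /= <- := congr1 (@^~ x) p2E.
exact: surjective_pairing.
Qed.

Lemma plot_sample_smooth (Y : sss R) (Z : plot Y m) :
  @sample_smooth R (OmegaS R m) Y (sval Z).
Proof. by move=> n p hp; exact: plots_comp (svalP Z) hp. Qed.

Lemma sample_smooth_comp (X1 X2 X3 : plotSpace R) (f : X1 -> X2)
    (g : X2 -> X3) :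
  sample_smooth f -> sample_smooth g -> sample_smooth (g \o f).
Proof. by move=> hf hg n p hp; exact: hg (hf _ _ hp). Qed.

(** One half of the Yoneda lemma: the plot is the image of the universal plot,
    the identity of the test object. *)
Lemma sampler_plot (Y : sss R)
    (F : sss_hom (prodS (realS R m) (flatOmega R)) Y) : plots (sval F).
Proof.
exact: (sample_smooth_comp OmegaN_to_prod_smooth (svalP F) (id_site_hom R m)).
Qed.

End test_object.

(** * The family of laws of a plot *)

Section law_family.
Context (R : realType) (U : probability (Omega R) R) (Y : sss R) (m : nat).

Lemma law_plot_is_law (Z : plot Y m) (t : 'rV[R]_m) :
  is_law (law U (fun w => sval Z (t, w))).
Proof.
exists (fun w => sval Z (t, w)), U; split=> //.
apply: (plots_comp (h := fun p : OmegaN R 0 => (t, p.2)) (svalP Z)).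
by exists (fun=> t), id; split; [exact: mixed_smooth_cst | exact: measurable_id |].
Qed.

Definition law_family_fun (Z : plot Y m) : realS R m -> PS U Y :=
  fun t => exist _ _ (law_plot_is_law Z t).

(** Half of the sample computes the parameter and the other half runs Z. *)
Lemma law_family_sample_smooth (Z : plot Y m) :
  sample_smooth (law_family_fun Z).
Proof.
move=> n g mg /=.
pose h (p : OmegaN R n) : OmegaN R m :=
  (g (p.1, (Theta p.2).1), (Theta p.2).2).
exists (sval Z \o h).
- apply: plots_comp (svalP Z) _.
  exists (fun p => g (p.1, (Theta p.2).1)), (fun w => (Theta w).2); split=> //.
    exact: (mixed_smooth_comp_sample mg (@measurable_Theta1 R)).
  exact: measurable_Theta2.
- move=> t w; congr (law U); apply/funext => w'.
  by rewrite /comp /h Theta_invK.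
Qed.

Definition law_family (Z : plot Y m) : sss_hom (realS R m) (PS U Y) :=
  exist _ _ (@law_family_sample_smooth Z).

Lemma law_family_eq (Z : plot Y m) (f : sss_hom (realS R m) (PS U Y)) :
  (forall t, law U (fun w => sval Z (t, w)) = sval (sval f t)) ->
  law_family Z = f.
Proof.
case: f => f hf /= H; apply: eq_exist; apply/funext => t.
by case: (f t) (H t) => mu hmu /= E; exact: eq_exist.
Qed.

Lemma law_family_same_law (Z Z' : plot Y m) :
  law_family Z = law_family Z' -> same_law U Z Z'.
Proof.
move=> E; apply/asboolP => t.
exact: (congr1 (fun f : sss_hom (realS R m) (PS U Y) => sval (sval f t)) E).
Qed.

(** Applied to the projection that forgets the sample, smoothness of f
    yields a plot with two samples whose law in the second one is f t whatever
    the first one; freezing the first sample gives the plot sought. *)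
Lemma law_family_surjective (f : sss_hom (realS R m) (PS U Y)) :
  exists Z : plot Y m, law_family Z = f.
Proof.
have [W pW WE] := svalP f m _ (@mixed_smooth_fst R m).
pose w0 : Omega R := point.
pose h (p : OmegaN R m) : OmegaN R m := (p.1, Theta_inv (w0, p.2)).
have hh : site_hom h.
  exists fst, (fun w => Theta_inv (w0, w)); split=> //.
    exact: mixed_smooth_fst.
  exact: measurable_Theta_inv_fixl.
exists (exist _ _ (plots_comp pW hh)); apply: law_family_eq => t /=.
by rewrite -(WE t w0).
Qed.

Lemma same_law_repr (Z : plot Y m) (t : 'rV[R]_m) :
  law U (fun w => sval (repr (plot_class U Z)) (t, w)) =
  law U (fun w => sval Z (t, w)).
Proof.
have /eqquotP/asboolP -> // : repr (plot_class U Z) = Z %[mod plot_mod_law U Y m].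
exact: reprK.
Qed.

End law_family.

Theorem corollary6p22 (R : realType) (U : probability (Omega R) R)
    (U_uniform : is_uniform U) (m : nat) :
  (exists (phi : sss_hom (OmegaS R m) (prodS (realS R m) (flatOmega R)))
          (psi : sss_hom (prodS (realS R m) (flatOmega R)) (OmegaS R m)),
     [/\ cancel (sval phi) (sval psi),
         cancel (sval psi) (sval phi) &
         forall Y : sss R,
           exists G : sss_hom (prodS (realS R m) (flatOmega R)) Y -> plot Y m,
             (forall F, sval (G F) = sval F \o sval phi) /\ bijective G])
  /\
  (forall Y : sss R,
     exists L : plot_mod_law U Y m -> sss_hom (realS R m) (PS U Y),
       (forall (Z : plot Y m) (t : 'rV[R]_m),
          sval (sval (L (plot_class U Z)) t) =
          law U (fun w => sval Z (t, w))) /\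
       bijective L).
Proof.
split.
  exists (exist _ _ (@OmegaN_to_prod_smooth R m)).
  exists (exist _ _ (@prod_to_OmegaN_smooth R m)).
  split=> // Y.
  exists (fun F => exist _ _ (sampler_plot F)); split=> //.
  exists (fun Z => exist _ _ (sample_smooth_comp
    (@prod_to_OmegaN_smooth R m) (plot_sample_smooth Z))).
  - by move=> [F hF]; exact: eq_exist.
  - by move=> [Z hZ]; exact: eq_exist.
move=> Y; exists (fun q => law_family U (repr q)); split=> [Z t|].
  exact: same_law_repr.
have [inv invE] := choice (@law_family_surjective R U Y m).
exists (fun f => plot_class U (inv f)).
- move=> q; rewrite -[RHS]reprK; apply/eqquotP.
  by apply: law_family_same_law; exact: invE.
- move=> f; rewrite -[RHS]invE; apply: law_family_eq => t.
  by rewrite same_law_repr.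
Qed.
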